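(* For a balanced Theta graph $G$, it holds that $\mathrm{mdim}(G)=L_{1}(G)+2c(G)$.
   Context: All graphs are finite, simple and connected. $d(a,b)$ denotes the usual shortest-path distance between vertices $a,b$, and for a vertex $a$ and an edge $e=bc$ one sets $d(a,e)=\min\{d(a,b),d(a,c)\}$. A vertex $s\in V(G)$ distinguishes two distinct elements $x,x'\in V(G)\cup E(G)$ if $d(s,x)\neq d(s,x')$. A set $S\subseteq V(G)$ is a mixed metric generator of $G$ if every pair of distinct elements $x,x'\in V(G)\cup E(G)$ is distinguished by at least one vertex of $S$. The mixed metric dimension $\mathrm{mdim}(G)$ is the cardinality of a smallest mixed metric generator of $G$. For a graph $G$ with $n$ vertices and $m$ edges, $c(G)=m-n+1$ is the cyclomatic number, and $L_1(G)$ is the number of leaves (vertices of degree $1$) of $G$. A Theta graph is a graph with two vertices $u$ and $v$ of degree $3$, all other vertices being of degree $2$, consisting of three pairwise internally vertex-disjoint paths connecting $u$ and $v$. The length of a path is its number of edges. A Theta graph is balanced if the lengths of the three paths connecting $u$ and $v$ pairwise differ by at most $1$. *)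

(* Defs.v *)
(* MathComp. *)
From mathcomp Require Import all_boot all_order all_algebra.

Set Implicit Arguments.
Unset Strict Implicit.
Unset Printing Implicit Defensive.

Record cgraph := CGraph {
  vertex :> finType;
  adj : rel vertex;
  adj_sym : symmetric adj;
  adj_irrefl : irreflexive adj;
  adj_connected : forall x y : vertex, connect adj x y }.

Definition edges (G : cgraph) : {set {set G}} :=
  [set f : {set G} | [exists x, exists y, adj x y && (f == [set x; y])]].

Definition edge (G : cgraph) : finType := {f : {set G} | f \in edges G}.

Definition element (G : cgraph) : finType := (G + edge G)%type.

Definition degree (G : cgraph) (x : G) : nat := #|[set y | adj x y]|.

Definition walk_of_length (G : cgraph) (x y : G) (n : nat) : bool :=
  [exists p : n.-tuple G, path (@adj G) x p && (last x p == y)].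

(* The least length of a walk from x to y, see distP; only lengths below #|G|
   are tried, which suffices because a shortest walk repeats no vertex. *)
Definition dist (G : cgraph) (x y : G) : nat :=
  find (walk_of_length x y) (iota 0 #|G|).

(* The default value #|G| of the minimum exceeds every distance: on an edge bc
   this is min(d(s,b), d(s,c)), see dist_edgeE. *)
Definition dist_elt (G : cgraph) (s : G) (a : element G) : nat :=
  match a with
  | inl x => dist s x
  | inr f => \big[Order.min/#|G|]_(b in val f) dist s b
  end.

Definition distinguishes (G : cgraph) (s : G) (a b : element G) : bool :=
  dist_elt s a != dist_elt s b.

Definition mixed_metric_generator (G : cgraph) (S : {set G}) : bool :=
  [forall a : element G, forall b : element G,
     (a != b) ==> [exists s in S, distinguishes s a b]].

(* The default value setT of the arg min is itself a mixed metric generator: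
   see generator_setT. *)
Definition mdim (G : cgraph) : nat :=
  #|[arg min_(S < [set: G] | mixed_metric_generator S) #|S|]|.

Definition leaves (G : cgraph) : nat := #|[set x : G | degree x == 1]|.

(* int-valued: subtraction on nat would truncate. *)
Definition cyclomatic (G : cgraph) : int :=
  (#|edges G|%:Z - #|G|%:Z + 1)%R.

(* A path between u and v is given by the sequence s of its internal
   vertices. *)
Definition is_uv_path (G : cgraph) (u v : G) (s : seq G) : bool :=
  path (@adj G) u (rcons s v) && uniq (u :: rcons s v).

Definition path_length (G : cgraph) (s : seq G) : nat := (size s).+1.

Definition path_edge (G : cgraph) (u v : G) (s : seq G) (x y : G) : bool :=
  let steps := zip (u :: s) (rcons s v) in
  ((x, y) \in steps) || ((y, x) \in steps).

Definition theta_structure (G : cgraph) (u v : G) (P : 'I_3 -> seq G) : Prop :=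
  [/\ degree u = 3 /\ degree v = 3,
      forall x, x != u -> x != v -> degree x = 2,
      forall i, is_uv_path u v (P i),
      forall i j, i != j -> [disjoint P i & P j] &
      (forall x, [|| x == u, x == v | [exists i, x \in P i]]) /\
      (forall x y, adj x y -> exists i, path_edge u v (P i) x y)].

Definition balanced_theta_graph (G : cgraph) : Prop :=
  exists (u v : G) (P : 'I_3 -> seq G),
    theta_structure u v P /\
    forall i j, path_length (P i) <= path_length (P j) + 1.

Lemma distP (G : cgraph) (x y : G) :
  [/\ dist x y < #|G|, walk_of_length x y (dist x y) &
      forall n, walk_of_length x y n -> dist x y <= n].
Proof.
have hasw : has (walk_of_length x y) (iota 0 #|G|).
  have /connectP[p0 + ->] := adj_connected x y.
  case/shortenP => p pp up _; apply/hasP; exists (size p).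
    rewrite mem_iota /= add0n.
    by rewrite -/(size (x :: p)) -(card_uniqP up) max_card.
  by apply/existsP; exists (in_tuple p); rewrite /= pp eqxx.
have ltd : dist x y < #|G| by rewrite -[X in _ < X](size_iota 0) -has_find.
split=> // [|n wn].
  by have := nth_find 0 hasw; rewrite -/(dist x y) nth_iota.
rewrite leqNgt; apply/negP => ltn.
by have := before_find 0 ltn; rewrite nth_iota ?wn // (ltn_trans ltn ltd).
Qed.

Lemma dist_eq0 (G : cgraph) (x y : G) : (dist x y == 0) = (x == y).
Proof.
have [_ wd dmin] := distP x y; apply/eqP/eqP => [d0|exy].
  by move: wd; rewrite d0 => /existsP[p]; rewrite tuple0 /= => /eqP.
apply/eqP; rewrite -leqn0; apply: dmin.
by apply/existsP; exists [tuple]; rewrite /= exy eqxx.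
Qed.

Lemma edge_ends (G : cgraph) (f : edge G) :
  exists x y : G, [/\ adj x y, x != y & val f = [set x; y]].
Proof.
have := valP f; rewrite inE => /existsP[x /existsP[y /andP[xy /eqP E]]].
exists x, y; split=> //; apply/eqP => exy.
by move: xy; rewrite exy adj_irrefl.
Qed.

Lemma dist_edgeE (G : cgraph) (s x y : G) (f : edge G) :
  val f = [set x; y] -> dist_elt s (inr f) = minn (dist s x) (dist s y).
Proof.
move=> /= ->; rewrite Order.TotalTheory.bigminU.
rewrite !Order.TotalTheory.bigmin_set1 !minEnat.
have [/ltnW/minn_idPl-> _ _] := distP s x.
by have [/ltnW/minn_idPl-> _ _] := distP s y.
Qed.

Lemma dist_elt_eq0 (G : cgraph) (s : G) (a : element G) :
  (dist_elt s a == 0) =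
  match a with inl x => s == x | inr f => s \in val f end.
Proof.
case: a => [x|f]; first exact: dist_eq0.
have [x [y [_ _ E]]] := edge_ends f.
rewrite (dist_edgeE s E) E !inE -!dist_eq0.
by case: (dist s x) (dist s y) => [|m] [|n] //; rewrite minnSS.
Qed.

Lemma generator_setT (G : cgraph) : mixed_metric_generator [set: G].
Proof.
apply/forallP => a; apply/forallP => b; apply/implyP; apply: contraR => nd.
have E s : (dist_elt s a == 0) = (dist_elt s b == 0).
  move: nd; rewrite negb_exists => /forallP/(_ s).
  by rewrite inE /distinguishes /= negbK => /eqP->.
case: a b {nd} E => [x|f] [y|g] E; apply/eqP.
- by have := E x; rewrite !dist_elt_eq0 eqxx => /esym/eqP->.
- have [u [v [_ uv Eg]]] := edge_ends g.
  have := E u; have := E v; rewrite !dist_elt_eq0 Eg !inE !eqxx orbT.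
  by move=> /eqP ev /eqP eu; rewrite eu ev eqxx in uv.
- have [u [v [_ uv Ef]]] := edge_ends f.
  have := E u; have := E v; rewrite !dist_elt_eq0 Ef !inE !eqxx orbT.
  by move=> /esym/eqP ev /esym/eqP eu; rewrite eu ev eqxx in uv.
- congr inr; apply/val_inj/setP => s.
  by have := E s; rewrite !dist_elt_eq0.
Qed.

(* Main.v *)
Require Import Defs.
From mathcomp Require Import all_boot all_order all_algebra.
From mathcomp Require Import zify.

(** A generator must contain, for every vertex and every edge at it, a vertex
strictly closer to the other end of that edge; and in a balanced theta graph
shortest paths are so rigid that this is very restrictive.  Number the
vertices of the i-th path from u to v by their position 0, ..., l i.  As the
lengths differ by at most 1, a vertex s inside path i is at distance |t - y|
from position y of its own path, where t is its position, and at distance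
min (t + y, (l i - t) + (l j - y)) from position y of another path j
([dist_pos]): no shortest path from s needs a detour through the third path.
The same formula holds for u and v seen as ends of a shortest path.  It extends
to edges, an edge being a segment of length e = 1 and a vertex a segment of
length e = 0 on a path.

Upper bound.  The distances from u and v determine y and l i - (y + e).  Hence
they determine a segment among those of one path, and between two paths the
ambiguity is resolved by any interior vertex of one of them.  So u, v and one
interior vertex of each path but a shortest one form a generator of size 4
([generator_four]).

Lower bound.  Suppose that a generator S has at most 3 vertices.  Looking at
the first and the last edge of path i shows that S has an interior vertex of
path i, or else contains both u and v and path i is a shortest one
([generator_hits]).  If some path is missed, then u, v use up two of the three
vertices, so a second path is missed; S then cannot tell apart the first inner
vertices of these two paths, which have equal length ([two_missed]).

Otherwise S consists of one interior vertex s_i on each path.  The edges at s_i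
force some shortest path from S to enter s_i from the side of u and some from
the side of v; comparing signs, two of the vertices, say s_a and s_b, are
antipodal on their cycle, while the third, s_c, reaches s_b through u and
s_a through v ([antipodal_pair]).  The reflection of this cycle that fixes s_a
and s_b preserves the distances to both.  From s_b to s_a, the distance to s_c
is at first not larger on the u side than on the v side, and at the end not
smaller, so by a discrete intermediate value argument some two vertices or two edges that
the reflection swaps are at the same distance from s_c ([arcs_cross]); they are
not distinguished.

Thus the dimension is 4.  There are no leaves, and counting degrees gives
n + 1 edges, so the cyclomatic number is 2. *)

Set Implicit Arguments.
Unset Strict Implicit.
Unset Printing Implicit Defensive.

(** * Distances and mixed metric generators *)

Section Graphs.
Variable G : cgraph.
Implicit Types (s x y : G) (S : {set G}).

Lemma dist_path x y :
  exists p, [/\ path (@adj G) x p, last x p = y & size p = dist x y].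
Proof.
have [_ /existsP[p /andP[xp /eqP yp]] _] := distP x y.
by exists p; split=> //; rewrite size_tuple.
Qed.

Lemma distxx x : dist x x = 0.
Proof. by apply/eqP; rewrite dist_eq0. Qed.

Lemma dist_adj s x y : adj x y -> dist s y <= (dist s x).+1.
Proof.
move=> xy; have [p [sp px <-]] := dist_path s x.
have [_ _] := distP s y; apply; apply/existsP.
have sz : size (rcons p y) == (size p).+1 by rewrite size_rcons.
by exists (Tuple sz); rewrite /= rcons_path sp px xy last_rcons eqxx.
Qed.

Lemma adj_edge x y : adj x y -> exists f : edge G, val f = [set x; y].
Proof.
move=> xy; have xyE : [set x; y] \in edges G.
  by rewrite inE; apply/existsP; exists x; apply/existsP; exists y; rewrite xy /=.
by exists (Sub [set x; y] xyE).
Qed.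

Lemma generatorP S :
  reflect (forall a b : element G, {in S, forall s, dist_elt s a = dist_elt s b} ->
             a = b)
          (mixed_metric_generator S).
Proof.
apply: (iffP forallP) => [gen a b eqab | gen a].
  have /forallP/(_ b) := gen a; case: eqVneq => //= _ /existsP[s /andP[sS]].
  by rewrite /distinguishes eqab ?eqxx.
apply/forallP => b; apply/implyP; apply: contraR => nd; apply/eqP/gen => s sS.
by apply/eqP; apply: contraR nd => ds; apply/existsP; exists s; rewrite sS.
Qed.

Lemma mdim_leq S : mixed_metric_generator S -> mdim G <= #|S|.
Proof.
move=> genS; rewrite /mdim; case: arg_minnP => [|T _]; first exact: generator_setT.
exact.
Qed.

Lemma mdim_geq n :
  (forall S, mixed_metric_generator S -> n <= #|S|) -> n <= mdim G.
Proof.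
move=> minn; apply: minn; case: arg_minnP => //; exact: generator_setT.
Qed.

Lemma generator_vertices S x y :
  mixed_metric_generator S -> {in S, forall s, dist s x = dist s y} -> x = y.
Proof. by move=> /generatorP gen /(gen (inl x) (inl y)) []. Qed.

Lemma generator_edges S x y x' y' :
    mixed_metric_generator S -> adj x y -> adj x' y' ->
    {in S, forall s,
      minn (dist s x) (dist s y) = minn (dist s x') (dist s y')} ->
  x' = x \/ x' = y.
Proof.
move=> /generatorP gen /adj_edge[f fE] /adj_edge[g gE] eqd.
have [fg]: inr f = inr g :> element G.
  by apply: gen => s sS; rewrite (dist_edgeE s fE) (dist_edgeE s gE) eqd.
by apply/pred2P; rewrite -in_set2 -fE fg gE set21.
Qed.

(** This is what distinguishing x from the edge xy means. *)
Lemma generator_closer S x y :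
  mixed_metric_generator S -> adj x y -> exists2 s, s \in S & dist s y < dist s x.
Proof.
move=> /generatorP gen xy; have [f fE] := adj_edge xy.
have [/exists_inP //| no] := boolP [exists s in S, dist s y < dist s x].
suff: inl x = inr f :> element G by [].
apply: gen => s sS; rewrite (dist_edgeE s fE) /=.
suff: dist s x <= dist s y by move/minn_idPl.
by rewrite leqNgt; apply: contra no => lt_yx; apply/exists_inP; exists s.
Qed.

(** Double counting of the incident pairs of a vertex and an edge. *)
Lemma handshake : \sum_(x : G) degree x = 2 * #|edges G|.
Proof.
have degE x : degree x = \sum_(f in edges G) (x \in f).
  rewrite -big_mkcondr /= -[RHS]/(\sum_(f in edges G | x \in f) 1) sum1dep_card.
  rewrite /degree -(card_in_imset (f := fun y => [set x; y])) /=; last first.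
    move=> y z; rewrite !inE => xy _ /setP/(_ y); rewrite !inE eqxx orbT.
    by case/esym/orP => /eqP // yx; rewrite yx adj_irrefl in xy.
  apply: eq_card => f; rewrite inE; apply/imsetP/andP => [[y]|[]].
    rewrite inE => xy ->; rewrite set21 inE; split=> //.
    by apply/existsP; exists x; apply/existsP; exists y; rewrite xy /=.
  rewrite inE => /existsP[y /existsP[z /andP[yz /eqP->]]] /set2P[]->.
    by exists z; rewrite ?inE.
  by exists y; rewrite ?inE 1?adj_sym // setUC.
under eq_bigr do rewrite degE.
rewrite exchange_big /= mulnC -sum_nat_const; apply: eq_bigr => f fE.
have [x [y [_ xy /= ->]]] := edge_ends (Sub f fE : edge G).
transitivity #|[set x; y]|; last by rewrite cards2 xy.
by rewrite -sum1_card [RHS]big_mkcond; apply: eq_bigr => z _; case: ifP.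
Qed.

(** A sign change of f - g happens at a zero of f - g or between two consecutive
integers. *)
Lemma discrete_crossing (f g : nat -> nat) n :
    1 < n -> f 1 <= g 1 -> g n.-1 <= f n.-1 ->
  exists h, 0 < h < n /\
    (f h = g h \/ [/\ h.+1 < n, f h < g h & g h.+1 < f h.+1]).
Proof.
move=> n1 fg1 gfn.
have exh : exists h, (0 < h) && (g h <= f h) by exists n.-1; rewrite gfn; lia.
case: (ex_minnP exh) => -[//|h] /= gfh minh.
have hn : h.+1 < n by have := minh n.-1; rewrite gfn andbT; lia.
have [eqh|neqh] := eqVneq (f h.+1) (g h.+1).
  by exists h.+1; split=> //; left.
case: h gfh minh hn neqh => [|h] gfh minh hn neqh; first by lia.
exists h.+1; split; [by lia|right; split=> //; last by lia].
by rewrite ltnNge; apply/negP => gf; have := minh h.+1; rewrite gf ltnn => /(_ isT).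
Qed.

(** A path that runs from s to s' as if on a cycle of length 2n on which s and s'
are antipodal: positions along it are recorded by the distances to s and s'. *)
Record arc s s' n (Q : nat -> G) : Prop := Arc {
  arc_adj : forall h, h < n -> adj (Q h) (Q h.+1);
  arc_start : forall h, h <= n -> dist s (Q h) = h;
  arc_end : forall h, h <= n -> dist s' (Q h) = n - h }.

(** The two arcs are the halves of such a cycle.  The difference of the distances
from r to the two arcs changes sign along them.  If it never vanishes then it
jumps from negative to positive at one step; distances vary by at most 1 along
an edge, so it jumps from -1 to 1, and the two edges crossed at that step are
at the same distance from r. *)
Lemma arcs_cross s s' r n Q Q' :
    arc s s' n Q -> arc s s' n Q' -> (forall h, 0 < h < n -> Q h <> Q' h) ->
    1 < n -> dist r (Q 1) <= dist r (Q' 1) ->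
    dist r (Q' n.-1) <= dist r (Q n.-1) ->
  ~ mixed_metric_generator [set s; s'; r].
Proof.
move=> arcQ arcQ' neqQ n1 le1 len gen.
have [h [hn [eqd|[hn1 lth gth]]]] :=
  @discrete_crossing (dist r \o Q) (dist r \o Q') n n1 le1 len.
  apply: (neqQ h hn); apply: generator_vertices gen _ => x.
  have hn' : h <= n by lia.
  rewrite !inE -orbA => /or3P[] /eqP->; last exact: eqd.
    by rewrite (arc_start arcQ) // (arc_start arcQ').
  by rewrite (arc_end arcQ) // (arc_end arcQ').
have hn0 : h < n by lia.
have hn' : h <= n by lia.
have step := arc_adj arcQ hn0; have step' := arc_adj arcQ' hn0.
have dQ := dist_adj r step; have dQ' : dist r (Q' h) <= (dist r (Q' h.+1)).+1.
  by apply: dist_adj; rewrite adj_sym.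
move: lth gth => /= lth gth.
have : Q' h = Q h \/ Q' h = Q h.+1.
  apply: (generator_edges gen step step') => x.
  rewrite !inE -orbA => /or3P[] /eqP->; last by lia.
    by rewrite !(arc_start arcQ) // !(arc_start arcQ').
  by rewrite !(arc_end arcQ) // !(arc_end arcQ').
case=> eqQ; first by move: lth; rewrite eqQ ltnn.
by have := arc_start arcQ' hn'; rewrite eqQ (arc_start arcQ) //; lia.
Qed.

End Graphs.

(** * Coordinates on a theta graph *)

Section Theta.
Variables (G : cgraph) (u v : G) (P : 'I_3 -> seq G).
Hypothesis thetaP : theta_structure u v P.
Implicit Types (i j k : 'I_3) (s x : G) (S : {set G}).

Let l i := path_length (P i).

Definition pos i y : G := nth v (u :: rcons (P i) v) y.

Lemma pos0 i : pos i 0 = u. Proof. by []. Qed.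

Lemma pos_len i : pos i (l i) = v.
Proof. by rewrite /pos /= nth_rcons ltnn eqxx. Qed.

Lemma adj_pos i y : y < l i -> adj (pos i y) (pos i y.+1).
Proof.
move=> ltyl; have [_ _ /(_ i)/andP[/(pathP v) adjP _] _ _] := thetaP.
by apply: adjP; rewrite size_rcons.
Qed.

Lemma uniq_ends i : [/\ u != v, u \notin P i & v \notin P i].
Proof.
have [_ _ /(_ i)/andP[_ +] _ _] := thetaP.
rewrite /= rcons_uniq mem_rcons inE negb_or => /and3P[/andP[-> ->] -> _].
by [].
Qed.

Lemma mem_pos i y : 0 < y < l i -> pos i y \in P i.
Proof.
case: y => //= y lty; have {}lty : y < size (P i) by [].
by rewrite /pos /= nth_rcons lty mem_nth.
Qed.

Lemma pos_cases i y : y <= l i ->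
  [\/ y = 0 /\ pos i y = u, y = l i /\ pos i y = v | 0 < y < l i].
Proof.
case: y => [|y]; first by constructor 1.
rewrite leq_eqVlt => /predU1P[->|lty]; last by constructor 3.
by constructor 2; rewrite pos_len.
Qed.

Lemma pos_inj i j y z : y <= l i -> z <= l j -> pos i y = pos j z ->
  [\/ i = j /\ y = z, y = 0 /\ z = 0 | y = l i /\ z = l j].
Proof.
move=> yi zj eqp; have [eqij|neqij] := eqVneq i j.
  constructor 1; split=> //; move: zj eqp; rewrite -{}eqij /pos => zi /eqP.
  have [_ _ /(_ i)/andP[_ Ui] _ _] := thetaP.
  by rewrite nth_uniq //= ?size_rcons // => /eqP.
have [uv ui vi] := uniq_ends i; have [_ uj vj] := uniq_ends j.
have vu : (v == u) = false by rewrite eq_sym (negPf uv).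
case: (pos_cases yi) (pos_cases zj) => [[y0 pu]|[yl pv]|/mem_pos ym]
  [[z0 qu]|[zl qv]|/mem_pos zm].
- by constructor 2.
- by move: uv; rewrite -pu -qv eqp eqxx.
- by move: uj; rewrite -pu eqp zm.
- by move: uv; rewrite -pv -qu eqp eqxx.
- by constructor 3.
- by move: vj; rewrite -pv eqp zm.
- by move: ui; rewrite -qu -eqp ym.
- by move: vi; rewrite -qv -eqp ym.
- have [_ _ _ /(_ i j neqij)/disjointFr/(_ ym) + _] := thetaP.
  by rewrite eqp zm.
Qed.

Lemma pos_cover x :
  [\/ x = u, x = v | exists i y, 0 < y < l i /\ x = pos i y].
Proof.
have [_ _ _ _ [/(_ x)/or3P[/eqP->|/eqP->|/existsP[i xi]] _]] := thetaP.
- by constructor 1.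
- by constructor 2.
have lti : index x (P i) < size (P i) by rewrite index_mem.
constructor 3; exists i, (index x (P i)).+1; split=> //.
by rewrite /pos /= nth_rcons lti nth_index.
Qed.

Lemma adj_posE x x' : adj x x' -> exists i y, y < l i /\
  (x = pos i y /\ x' = pos i y.+1 \/ x' = pos i y /\ x = pos i y.+1).
Proof.
have [_ _ _ _ [_ /[apply] [[i xx']]]] := thetaP; exists i.
have sz : size (u :: P i) = size (rcons (P i) v) by rewrite size_rcons.
have step w w' : (w, w') \in zip (u :: P i) (rcons (P i) v) ->
    exists2 y, y < l i & w = pos i y /\ w' = pos i y.+1.
  move/(nthP (v, v)) => [y]; rewrite size_zip -sz minnn => lty.
  rewrite nth_zip // => -[<- <-]; exists y => //; split=> //.
  by rewrite /pos -rcons_cons nth_rcons lty.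
by move: xx' => /orP[] /step[y lty eqy]; exists y; split=> //; [left|right].
Qed.

Lemma len_gt0 i : 0 < l i. Proof. by []. Qed.

(** Otherwise two of the three paths leave u by the edge uv, and u would have at
most two neighbours. *)
Lemma no_parallel i j : i != j -> l i = 1 -> 1 < l j.
Proof.
move=> neqij li1; rewrite ltn_neqAle len_gt0 andbT eq_sym; apply/eqP => lj1.
have [[degu _] _ _ _ _] := thetaP.
have : degree u <= #|[set pos k 1 | k in [set~ i]]|.
  apply/subset_leq_card/subsetP => x; rewrite inE => /adj_posE[k [y [lty uE]]].
  have [uv _ _] := uniq_ends i.
  have {uE} : x = pos k 1.
    case: uE => [[uE ->]|[-> uE]].
      have := @pos_inj k k y 0 (ltnW lty) isT; rewrite -uE pos0.
      by case=> // [[_ ->]|[-> _]|[yl _]] //; rewrite yl ltnn in lty.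
    have := @pos_inj k k y.+1 0 lty isT; rewrite -uE pos0.
    by case=> // -[].
  have [->|nki ->] := eqVneq k i; last by apply: imset_f; rewrite !inE.
  have posv m : l m = 1 -> pos m 1 = v by move=> <-; exact: pos_len.
  by rewrite (posv i) // -(posv j) // => ->; apply: imset_f; rewrite !inE eq_sym.
rewrite degu leqNgt; apply/negP; rewrite negbK.
by apply: leq_ltn_trans (leq_imset_card _ _) _; rewrite cardsC1 card_ord.
Qed.

(** * Leaves and cyclomatic number *)

Lemma theta_leaves : leaves G = 0.
Proof.
have [[du dv] d2 _ _ _] := thetaP; apply/eqP; rewrite cards_eq0; apply/eqP.
apply/setP => x; rewrite !inE.
by case: (eqVneq x u) (eqVneq x v) => [->|xu] [->|xv]; rewrite ?du ?dv ?d2.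
Qed.

Lemma theta_cyclomatic : cyclomatic G = 2%R.
Proof.
have [[du dv] d2 _ _ _] := thetaP; have [uv _ _] := uniq_ends ord0.
have := handshake G; rewrite (bigD1 u) // (bigD1 v) 1?eq_sym //= du dv.
under eq_bigr => x /andP[xu xv] do rewrite d2 //.
have : \sum_(x : G) 1 = #|G| by rewrite sum1_card.
rewrite (bigD1 u) // (bigD1 v) 1?eq_sym //= sum1_card sum_nat_const /cyclomatic.
move: #|edges G| #|G| #|_| => m n k; lia.
Qed.

(** * Distances in a theta graph *)

Lemma dist_slide s i y z : y <= l i -> z <= l i ->
  dist s (pos i z) <= dist s (pos i y) + ((y - z) + (z - y)).
Proof.
have up a d : a + d <= l i -> dist s (pos i (a + d)) <= dist s (pos i a) + d.
  elim: d => [|d IHd]; rewrite ?addn0 // addnS => lt_adl.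
  by have := dist_adj s (adj_pos lt_adl); have := IHd (ltnW lt_adl); lia.
have down a d : a + d <= l i -> dist s (pos i a) <= dist s (pos i (a + d)) + d.
  elim: d => [|d IHd]; rewrite ?addn0 // addnS => lt_adl.
  have := adj_pos lt_adl; rewrite adj_sym => /(dist_adj s).
  by have := IHd (ltnW lt_adl); lia.
move=> yl zl; case: (leqP y z) => [yz|/ltnW zy].
  by have := @up y (z - y); rewrite subnKC // => /(_ zl); lia.
by have := @down z (y - z); rewrite subnKC // => /(_ yl); lia.
Qed.

(** Distances are bounded below by potentials: a function on the positions that
agrees at the glued ends is a function on the vertices, and if it varies by at
most 1 along edges then it grows by at most n along a walk of length n. *)
Lemma dist_potential (F : 'I_3 -> nat -> nat) i j y z :
    (forall k k', F k 0 = F k' 0 /\ F k (l k) = F k' (l k')) ->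
    (forall k a, a < l k -> F k a <= (F k a.+1).+1 /\ F k a.+1 <= (F k a).+1) ->
    y <= l i -> z <= l j ->
  F j z <= F i y + dist (pos i y) (pos j z).
Proof.
move=> endF lipF yi zj.
have wdF k k' a b : a <= l k -> b <= l k' -> pos k a = pos k' b -> F k a = F k' b.
  move=> ak bk' /pos_inj[] // [-> ->] //; by case: (endF k k').
have [p [+ + <-]] := dist_path (pos i y) (pos j z).
elim: p i y yi => [|x p IHp] i y yi /= => [_ /wdF-> //|]; first by rewrite addn0.
case/andP=> /adj_posE[k [a [ltak xE]]] pathp lastp.
have [lip1 lip2] := lipF _ _ ltak.
case: xE => -[yE xE].
  have := IHp k a.+1 ltak; rewrite -xE => /(_ pathp lastp).
  by rewrite (wdF i k y a) // ?(ltnW ltak) //; lia.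
have := IHp k a (ltnW ltak); rewrite -yE => /(_ pathp lastp).
by rewrite (wdF i k y a.+1) //; lia.
Qed.

Hypothesis balanced : forall i j, l i <= (l j).+1.

(** From such a position the way to u along path i is no longer than the way
through v and another path, and likewise for v. *)
Definition central i t :=
  t <= l i /\ forall j, j != i -> 2 * t <= l i + l j /\ l i <= 2 * t + l j.

Lemma central_inner i t : 0 < t < l i -> central i t.
Proof.
by move=> ti; split=> [|j _]; [|have := balanced i j; have := balanced j i]; lia.
Qed.

Lemma central_shortest i t : (forall j, l i <= l j) -> t <= l i -> central i t.
Proof. by move=> shi ti; split=> // j _; have := shi j; lia. Qed.

(** The distance from position t of path i to the segment [y, y + e] of path j;
here subtraction is truncated, so that the first line vanishes when t lies in
the segment. *)
Definition dist_coord i t j y e :=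
  if i == j then (t - (y + e)) + (y - t)
  else minn (t + y) ((l i - t) + (l j - (y + e))).

(** Walking along the paths gives the upper bound; for the lower bound, the right
hand side is a potential, consistent at u and v because t is central. *)
Lemma dist_pos i t j z : central i t -> z <= l j ->
  dist (pos i t) (pos j z) = dist_coord i t j z 0.
Proof.
move=> [ti cen] zj; apply/eqP; rewrite eqn_leq; apply/andP; split.
  have := @dist_slide (pos i t) i t; rewrite distxx => slide.
  rewrite /dist_coord addn0; case: eqVneq => [eqij|neqij].
    by rewrite -{}eqij in zj *; exact: slide.
  rewrite leq_min; apply/andP; split.
    have := @dist_slide (pos i t) j 0 z isT zj.
    by have := slide 0 ti isT; rewrite !pos0; lia.
  have := @dist_slide (pos i t) j (l j) z (leqnn _) zj.
  by have := slide (l i) ti (leqnn _); rewrite !pos_len; lia.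
have := @dist_potential (fun k a => dist_coord i t k a 0) i j t z _ _ ti zj.
have -> : dist_coord i t i t 0 = 0 by rewrite /dist_coord eqxx; lia.
apply=> [k k'|k a ltak].
  have lenE m : i = m -> l m = l i by move=> ->.
  have := cen k; have := cen k'; rewrite ![_ == i]eq_sym /dist_coord.
  by case: (eqVneq i k) (eqVneq i k') => [/lenE ?|_] [/lenE ?|_]; split; lia.
rewrite /dist_coord; case: eqVneq => [ik|_]; last by lia.
by rewrite -ik in ltak; lia.
Qed.

(** Vertices and edges are both segments of a path, so that one distance formula
covers them. *)
Definition spans (a : element G) i y e :=
  match a with
  | inl x => [/\ e = 0, y <= l i & x = pos i y]
  | inr f => [/\ e = 1, y < l i & val f = [set pos i y; pos i y.+1]]
  end.

Lemma spans_bounds a i y e : spans a i y e -> e <= 1 /\ y + e <= l i.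
Proof. by case: a => [x|f] [-> yi _]; rewrite ?addn0 ?addn1. Qed.

Lemma spans_inj a b i y e : spans a i y e -> spans b i y e -> a = b.
Proof.
case: a b => [x|f] [x'|f'] [-> _ +] [] //; first by move=> -> _ _ ->.
by move=> fE _ _ f'E; congr inr; apply: val_inj; rewrite f'E.
Qed.

Lemma dist_elt_pos i t a j y e : central i t -> spans a j y e ->
  dist_elt (pos i t) a = dist_coord i t j y e.
Proof.
move=> cen; case: a => [x|f] [-> yj E]; first by rewrite /= E dist_pos.
rewrite (dist_edgeE _ E) !dist_pos // ?(ltnW yj) // /dist_coord.
by case: ifP => _; lia.
Qed.

(** Choosing path i0 for the coordinates of u and v, any element of another path
is centred strictly inside it. *)
Lemma spans_exist i0 a :
  exists i y e, spans a i y e /\ (i = i0 \/ 0 < y + y + e < 2 * l i).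
Proof.
case: a => [x|f].
  case: (pos_cover x) => [->|->|[i [y [yi ->]]]].
  - by exists i0, 0, 0; split=> //; left.
  - by exists i0, (l i0), 0; split; [split; rewrite ?pos_len|left].
  by exists i, y, 0; split; [split=> //|right]; lia.
have [x [x' [/adj_posE[i [y [yi xx']]] _ fE]]] := edge_ends f.
exists i, y, 1; split; last by right; lia.
by split=> //; case: xx' fE => -[-> ->] //; rewrite setUC.
Qed.

(** * A generator with four vertices *)

Lemma shortest_path : exists i0, forall j, l i0 <= l j.
Proof.
by exists [arg min_(i < ord0) l i]; case: arg_minnP => // i _ li j; exact: li.
Qed.

(** The probe is the vertex at position t of path i: it reaches a directly, but it
reaches b through u or v, and these routes are strictly longer since a is as
far from u and from v as b is. *)
Lemma probe_separates a b i j t y e z d :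
  i != j -> 0 < t < l i -> 0 < y + y + e < 2 * l i ->
  spans a i y e -> spans b j z d -> y = z -> l i - (y + e) = l j - (z + d) ->
  dist_elt (pos i t) a != dist_elt (pos i t) b.
Proof.
move=> ij ti yi sa sb *; have cen := central_inner ti.
have [[? ?] [? ?]] := (spans_bounds sa, spans_bounds sb).
rewrite (dist_elt_pos cen sa) (dist_elt_pos cen sb) /dist_coord eqxx (negPf ij).
lia.
Qed.

Lemma generator_four i0 : (forall j, l i0 <= l j) ->
  mixed_metric_generator ([set u; v] :|: [set pos j 1 | j in [set~ i0]]).
Proof.
move=> shi0; apply/generatorP => a b eqab.
have [i [y [e [sa inner_a]]]] := spans_exist i0 a.
have [j [z [d [sb inner_b]]]] := spans_exist i0 b.
have [[e1 ya] [d1 zb]] := (spans_bounds sa, spans_bounds sb).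
have cen0 t : t <= l i0 -> central i0 t by exact: central_shortest.
have : dist_elt u a = dist_elt u b by apply: eqab; rewrite !inE eqxx.
have : dist_elt v a = dist_elt v b by apply: eqab; rewrite !inE eqxx orbT.
rewrite -(pos_len i0) -(pos0 i0) !(dist_elt_pos (cen0 _ _) sa) //.
rewrite !(dist_elt_pos (cen0 _ _) sb) //.
have long k : k != i0 -> 1 < l k.
  move=> ki0; have := @no_parallel i0 k; rewrite eq_sym => /(_ ki0).
  by have := shi0 k; have := len_gt0 i0; lia.
have eqp k : k != i0 -> dist_elt (pos k 1) a = dist_elt (pos k 1) b.
  by move=> ki0; apply: eqab; rewrite inE orbC imset_f // !inE.
move=> eqv equ.
(* u and v are the two ends of path i0 *)
have dfar k c f : c + f <= l k -> f <= 1 ->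
    k = i0 \/ 0 < c + c + f < 2 * l k ->
    dist_coord i0 0 k c f = c /\ dist_coord i0 (l i0) k c f = l k - (c + f).
  move=> ck f1 inn; have := shi0 k; have := balanced k i0.
  rewrite /dist_coord; case: eqVneq => [ik|]; first by rewrite -ik in ck *; lia.
  by case: inn => [->|]; rewrite ?eqxx //; lia.
move: equ eqv.
have [-> ->] := dfar _ _ _ ya e1 inner_a.
have [-> ->] := dfar _ _ _ zb d1 inner_b => yz ends.
have [eqij|neqij] := eqVneq i j.
  subst j z; have ed : e = d by lia.
  by subst d; apply: spans_inj sa sb.
have [ii0|ii0] := eqVneq i i0; last first.
  case: inner_a => [eqi|inner_a]; first by rewrite eqi eqxx in ii0.
  by have /eqP[] := probe_separates (t := 1) neqij (long i ii0) inner_a sa sb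
    yz ends; exact: eqp.
have ji0 : j != i0 by rewrite -ii0 eq_sym.
case: inner_b => [eqj|inner_b]; first by rewrite eqj eqxx in ji0.
rewrite eq_sym in neqij.
by have /eqP[] := probe_separates (t := 1) neqij (long j ji0) inner_b sb sa
  (esym yz) (esym ends); exact/esym/eqp.
Qed.

Lemma mdim_leq4 : mdim G <= 4.
Proof.
have [i0 shi0] := shortest_path.
apply: leq_trans (mdim_leq (generator_four shi0)) _.
apply: leq_trans (leq_card_setU _ _) _; rewrite cards2.
apply: leq_trans (leq_add _ (leq_imset_card _ _)) _; first exact: (leqnn _.+1).
by rewrite cardsC1 card_ord; case: (_ != _).
Qed.

(** * No generator with three vertices *)

(** Only interior vertices of path i, and v when path i is shortest, are closer to
the neighbour of u on path i than to u; similarly at v. *)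
Lemma generator_hits S i : mixed_metric_generator S ->
  (exists t, 0 < t < l i /\ pos i t \in S) \/
  [/\ u \in S, v \in S & forall j, l i <= l j].
Proof.
move=> gen; have [i0 shi0] := shortest_path.
have inner k t : k != i -> 0 < t < l k ->
  dist (pos k t) (pos i 0) <= dist (pos k t) (pos i 1) /\
  dist (pos k t) (pos i (l i)) <= dist (pos k t) (pos i (l i).-1).
  move=> /negPf ki tk; have cen := central_inner tk.
  rewrite !(dist_pos cen) ?leq_pred // /dist_coord ki.
  by have := balanced k i; have := balanced i k; have := len_gt0 i; lia.
have fromu : (exists t, 0 < t < l i /\ pos i t \in S) \/
    (v \in S /\ forall j, l i <= l j).
  have [s sS] := generator_closer gen (adj_pos (len_gt0 i)).
  case: (pos_cover s) sS => [->|->|[k [t [tk ->]]]] sS; first by rewrite distxx.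
    rewrite -(pos_len i0).
    rewrite !(dist_pos (central_shortest shi0 (leqnn _))) // /dist_coord => lt01.
    right; split=> [|j]; first by rewrite pos_len.
    have := shi0 j; move: lt01.
    by case: eqVneq => [->|_] //; have := len_gt0 i; lia.
  have [ki|ki] := eqVneq k i; first by left; exists t; rewrite -ki.
  by have [] := inner k t ki tk; lia.
case: fromu => [|[vS shi]]; first by left.
have := @adj_pos i (l i).-1 (leqnn _); rewrite adj_sym.
move/(generator_closer gen)=> [s sS].
rewrite prednK ?len_gt0 //.
case: (pos_cover s) sS => [->|->|[k [t [tk ->]]]] sS.
- by right.
- by rewrite pos_len distxx.
have [ki|ki] := eqVneq k i; first by left; exists t; rewrite -ki.
by have [] := inner k t ki tk; lia.
Qed.

(** Both paths are then shortest, and the symmetry that exchanges them fixes S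
pointwise. *)
Lemma two_missed S i k : i != k ->
  (forall t, 0 < t < l i -> pos i t \notin S) ->
  (forall t, 0 < t < l k -> pos k t \notin S) ->
  ~ mixed_metric_generator S.
Proof.
move=> ik missi missk gen.
have short m : (forall t, 0 < t < l m -> pos m t \notin S) -> forall j, l m <= l j.
  by move=> miss; case: (generator_hits m gen) => [[t [/miss/negPf->]]|[]].
have [shi shk] := (short i missi, short k missk).
have lik : l i = l k by have := shi k; have := shk i; lia.
have eqd : {in S, forall s, dist s (pos i 1) = dist s (pos k 1)}.
  move=> s; case: (pos_cover s) => [->|->|[j [t [tj ->]]]] sS.
  - rewrite -(pos0 i) !(dist_pos (central_shortest shi _)) //.
    by rewrite /dist_coord eqxx (negPf ik); have := len_gt0 k; lia.
  - rewrite -(pos_len i) !(dist_pos (central_shortest shi (leqnn _))) //.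
    by rewrite /dist_coord eqxx (negPf ik); have := len_gt0 k; lia.
  have cen := central_inner tj; rewrite !(dist_pos cen) // /dist_coord.
  case: eqVneq => [eqj|_]; first by move: sS; rewrite eqj (negPf (missi t _)) -?eqj.
  case: eqVneq => [eqj|_]; first by move: sS; rewrite eqj (negPf (missk t _)) -?eqj.
  by rewrite lik.
have := generator_vertices gen eqd.
case/(pos_inj (len_gt0 i) (len_gt0 k)) => [[eqik]|[]|[li lk]] //.
  by rewrite eqik eqxx in ik.
by have := no_parallel ik (esym li); rewrite -lk.
Qed.

(** Each of the two edges at position t i of path i must be distinguished from that
vertex, by a vertex of another path that reaches it through this edge.  As 2 (t i + t j) - (l i + l j) is the excess of
the route from the j-th to the i-th vertex through u over the one through v,
this excess is nonnegative for some j and nonpositive for some j. *)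
Lemma opposite_signs S (t : 'I_3 -> nat) i :
    mixed_metric_generator S -> (forall k, 0 < t k < l k) ->
    (forall s, s \in S -> exists k, s = pos k (t k)) ->
  (exists2 j, j != i & l i + l j <= 2 * (t i + t j)) /\
  (exists2 j, j != i & 2 * (t i + t j) <= l i + l j).
Proof.
move=> gen tl onlyS; have /andP[ti0 til] := tl i; have step := adj_pos til.
have back : adj (pos i (t i)) (pos i (t i).-1).
  by rewrite adj_sym -{2}(prednK ti0); apply: adj_pos; lia.
split.
  have [s /onlyS[j ->]] := generator_closer gen step.
  have cen := central_inner (tl j); rewrite !(dist_pos cen) ?(ltnW til) //.
  have [->|ji] := eqVneq j i; first by rewrite /dist_coord eqxx; lia.
  by rewrite /dist_coord (negPf ji) => lt_d; exists j => //; have := tl j; lia.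
have [s /onlyS[j ->]] := generator_closer gen back.
have cen := central_inner (tl j).
rewrite !(dist_pos cen) ?(ltnW til) //; last by lia.
have [->|ji] := eqVneq j i; first by rewrite /dist_coord eqxx; lia.
by rewrite /dist_coord (negPf ji) => lt_d; exists j => //; have := tl j; lia.
Qed.

(** Among the three excesses, any two share an index, so by the hypotheses at that
index at most one is positive and at most one is negative.  Hence one of them
vanishes, and the two others are not of the same strict sign. *)
Lemma antipodal_pair (t : 'I_3 -> nat) :
    (forall i, exists2 j, j != i & l i + l j <= 2 * (t i + t j)) ->
    (forall i, exists2 j, j != i & 2 * (t i + t j) <= l i + l j) ->
  exists a b c, [/\ [/\ a != b, c != a & c != b], l a + l b = 2 * (t a + t b),
    2 * (t b + t c) <= l b + l c & l a + l c <= 2 * (t a + t c)].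
Proof.
pose o0 := @Ordinal 3 0 isT; pose o1 := @Ordinal 3 1 isT.
pose o2 := @Ordinal 3 2 isT.
have ord3 (Q : 'I_3 -> Prop) i : (exists2 j, j != i & Q j) ->
  [\/ o0 != i /\ Q o0, o1 != i /\ Q o1 | o2 != i /\ Q o2].
  case=> -[[|[|[|//]]] lt3] ji Qj; [constructor 1|constructor 2|constructor 3];
  by split; [move: ji|move: Qj]; congr (is_true (_ != _)) + congr Q; exact: val_inj.
move=> up dn.
have u0 : l o0 + l o1 <= 2 * (t o0 + t o1) \/ l o0 + l o2 <= 2 * (t o0 + t o2).
  by case/ord3: (up o0) => -[] // _; [left|right].
have u1 : l o1 + l o0 <= 2 * (t o1 + t o0) \/ l o1 + l o2 <= 2 * (t o1 + t o2).
  by case/ord3: (up o1) => -[] // _; [left|right].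
have u2 : l o2 + l o0 <= 2 * (t o2 + t o0) \/ l o2 + l o1 <= 2 * (t o2 + t o1).
  by case/ord3: (up o2) => -[] // _; [left|right].
have d0 : 2 * (t o0 + t o1) <= l o0 + l o1 \/ 2 * (t o0 + t o2) <= l o0 + l o2.
  by case/ord3: (dn o0) => -[] // _; [left|right].
have d1 : 2 * (t o1 + t o0) <= l o1 + l o0 \/ 2 * (t o1 + t o2) <= l o1 + l o2.
  by case/ord3: (dn o1) => -[] // _; [left|right].
have d2 : 2 * (t o2 + t o0) <= l o2 + l o0 \/ 2 * (t o2 + t o1) <= l o2 + l o1.
  by case/ord3: (dn o2) => -[] // _; [left|right].
pose good a b c := l a + l b = 2 * (t a + t b) /\
  2 * (t b + t c) <= l b + l c /\ l a + l c <= 2 * (t a + t c).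
have pick a b c : good a b c ->
    [/\ a != b, c != a & c != b] ->
  exists a b c, [/\ [/\ a != b, c != a & c != b], l a + l b = 2 * (t a + t b),
    2 * (t b + t c) <= l b + l c & l a + l c <= 2 * (t a + t c)].
  by case=> [ab [bc ac]] dis; exists a, b, c.
have : good o0 o1 o2 \/ good o1 o0 o2 \/ good o0 o2 o1 \/
    good o2 o0 o1 \/ good o1 o2 o0 \/ good o2 o1 o0 by rewrite /good; lia.
by case=> [|[|[|[|[|]]]]] /pick; apply.
Qed.

Section Antipodal.
Variables (a b : 'I_3) (ta tb : nat).
Hypotheses (ab : a != b) (tal : 0 < ta < l a) (tbl : 0 < tb < l b).
Hypothesis antipodal : l a + l b = 2 * (ta + tb).

(** The two ways around the cycle from position tb of path b to position ta of
path a: through u, and through v. *)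
Definition arc_u h := if h <= tb then pos b (tb - h) else pos a (h - tb).

Definition arc_v h :=
  if h <= l b - tb then pos b (tb + h) else pos a (l a - (h - (l b - tb))).

Lemma arc_uP : arc (pos b tb) (pos a ta) (ta + tb) arc_u.
Proof.
have cena := central_inner tal; have cenb := central_inner tbl.
split=> h hn; rewrite /arc_u.
- have [lt_htb|lt_tbh|->] := ltngtP h tb.
  + by rewrite adj_sym -(subnSK lt_htb); apply: adj_pos; lia.
  + by rewrite subSn ?(ltnW lt_tbh) //; apply: adj_pos; lia.
  by rewrite subnn subSnn pos0 -(pos0 a); exact: adj_pos.
- by case: leqP => htb; rewrite (dist_pos cenb) /dist_coord ?eqxx 1?eq_sym
    ?(negPf ab); lia.
by case: leqP => htb; rewrite (dist_pos cena) /dist_coord ?eqxx ?(negPf ab); lia.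
Qed.

Lemma arc_vP : arc (pos b tb) (pos a ta) (ta + tb) arc_v.
Proof.
have cena := central_inner tal; have cenb := central_inner tbl.
split=> h hn; rewrite /arc_v.
- have [lt_hb|lt_bh|eqh] := ltngtP h (l b - tb).
  + by rewrite addnS; apply: adj_pos; lia.
  + rewrite adj_sym.
    have -> : l a - (h - (l b - tb)) = (l a - (h.+1 - (l b - tb))).+1 by lia.
    by apply: adj_pos; lia.
  have -> : tb + h = l b by lia.
  rewrite pos_len -(pos_len a) adj_sym.
  have -> : l a - (h.+1 - (l b - tb)) = (l a).-1 by lia.
  by have := @adj_pos a (l a).-1; rewrite prednK ?len_gt0 //; apply; lia.
- by case: leqP => htb; rewrite (dist_pos cenb) /dist_coord ?eqxx 1?eq_sym
    ?(negPf ab); lia.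
by case: leqP => htb; rewrite (dist_pos cena) /dist_coord ?eqxx ?(negPf ab); lia.
Qed.

Lemma arcs_disjoint h : 0 < h < ta + tb -> arc_u h <> arc_v h.
Proof.
move=> hn; rewrite /arc_u /arc_v.
case: leqP => hu; case: leqP => hv eqp; have [] := pos_inj _ _ eqp; try lia.
all: by case=> eqab _; move: ab; rewrite eqab eqxx.
Qed.

End Antipodal.

Lemma one_on_each_path (t : 'I_3 -> nat) : (forall i, 0 < t i < l i) ->
  ~ mixed_metric_generator [set pos i (t i) | i : 'I_3].
Proof.
move=> tl gen.
have onlyS s : s \in [set pos i (t i) | i : 'I_3] -> exists k, s = pos k (t k).
  by case/imsetP=> k _ ->; exists k.
have signs i := opposite_signs i gen tl onlyS.
have [a [b [c [[ab ca cb] antip bc ac]]]] :=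
  antipodal_pair (fun i => (signs i).1) (fun i => (signs i).2).
have ta := tl a; have tb := tl b; have cen := central_inner (tl c).
have allS : [set pos i (t i) | i : 'I_3] =
    [set pos b (t b); pos a (t a); pos c (t c)].
  have abcT : [set b; a; c] = setT.
    apply/eqP; rewrite eqEcard subsetT cardsT card_ord setUC cardsU1 cards2.
    by rewrite !inE negb_or ca cb eq_sym ab.
  transitivity ((fun i => pos i (t i)) @: [set b; a; c]).
    by rewrite abcT; apply/setP => s; apply/imsetP/imsetP => -[i _ ->]; exists i.
  by rewrite !imsetU !imset_set1.
rewrite {}allS in gen.
have n1 : 1 < t a + t b by lia.
apply: (arcs_cross (arc_uP ab ta tb antip) (arc_vP ab ta tb antip) _ n1 _ _ gen).
- exact: arcs_disjoint.
- rewrite /arc_u /arc_v !ifT; try lia.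
  by rewrite !(dist_pos cen) // /dist_coord ?(negPf cb); lia.
rewrite /arc_u /arc_v.
case: (leqP _ (t b)) => ?; case: (leqP _ (l b - t b)) => ?.
all: rewrite !(dist_pos cen) /dist_coord ?(negPf ca) ?(negPf cb); lia.
Qed.

Lemma mdim_geq4 : 4 <= mdim G.
Proof.
apply: mdim_geq => S gen; rewrite ltnNge; apply/negP => cardS.
pose hit i t := (0 < t < l i) && (pos i t \in S).
pose H := [set i | [exists t : 'I_(l i), hit i t]].
have missH i t : i \notin H -> 0 < t < l i -> pos i t \notin S.
  rewrite inE negb_exists => /forallP miss ti; have /andP[_ til] := ti.
  by have := miss (Ordinal til); rewrite /hit ti.
have [t hitt] : exists t : 'I_3 -> nat, forall i, i \in H -> hit i (t i).
  apply: (@fin_all_exists _ _ (fun i t => i \in H -> hit i t)) => i.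
  have [|_] := boolP (i \in H); last by exists 0.
  by rewrite inE => /existsP[t ht]; exists t.
have inH i : i \in H -> 0 < t i < l i /\ pos i (t i) \in S by move/hitt/andP.
have injt : {in H &, injective (fun i => pos i (t i))}.
  by move=> i j /inH[ti _] /inH[tj _] /= /pos_inj[]; try lia; case.
have imS : [set pos i (t i) | i in H] \subset S.
  by apply/subsetP => _ /imsetP[i /inH[_ iS] ->].
have [allH|/subsetPn[i _ iH]] := boolP ([set: 'I_3] \subset H).
  have HT : H = setT by apply/eqP; rewrite eqEsubset subsetT.
  have tl i : 0 < t i < l i by have [] := inH i; rewrite ?HT.
  apply: (one_on_each_path tl).
  have <- // : S = [set pos i (t i) | i : 'I_3].
  apply/esym/eqP; rewrite eqEcard; apply/andP; split.
    by apply: subset_trans imS; apply: imsetS; rewrite HT.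
  have card3 : 3 = #|H| by rewrite HT cardsT card_ord.
  apply: leq_trans cardS _; rewrite {1}card3 -(card_in_imset injt).
  by apply/subset_leq_card/subsetP => _ /imsetP[i _ ->]; exact: imset_f.
have [[t0 [/(missH _ _ iH)/negPf-> //]]|[uS vS _]] := generator_hits i gen.
have cardH : #|[set u; v] :|: [set pos i (t i) | i in H]| <= 3.
  apply: leq_trans cardS; apply/subset_leq_card; rewrite subUset imS andbT.
  by apply/subsetP => x /set2P[]->.
have [uv _ _] := uniq_ends i.
have dis : [disjoint [set u; v] & [set pos i (t i) | i in H]].
  rewrite -setI_eq0; apply/eqP/setP => x; rewrite !inE; apply/negP => /andP[uvx].
  case/imsetP=> k /inH[tk _] xk; have := mem_pos tk; rewrite -xk => xP.
  have [_ uk vk] := uniq_ends k.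
  by case/orP: uvx => /eqP xE; rewrite -xE xP in uk vk.
rewrite cardsU (disjoint_setI0 dis) cards0 subn0 cards2 uv card_in_imset // in cardH.
have : 1 < #|~: H| by have := cardsC H; rewrite card_ord; lia.
case/card_gt1P => j [k [jH kH jk]]; rewrite !inE in jH kH.
by apply: (two_missed jk _ _ gen) => t0; apply: missH; rewrite inE.
Qed.

Lemma mdim_theta : mdim G = 4.
Proof. by apply/eqP; rewrite eqn_leq mdim_leq4 mdim_geq4. Qed.

End Theta.

Theorem corollary8 (G : cgraph) (hG : balanced_theta_graph G) :
  ((mdim G)%:Z = (leaves G)%:Z + 2 * cyclomatic G)%R.
Proof.
case: hG => u [v [P [thetaP bal]]].
rewrite (theta_leaves thetaP) (theta_cyclomatic thetaP) (mdim_theta thetaP) //.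
by move=> i j; have := bal i j; rewrite addn1.
Qed.
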